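(* Let $V$ be a totally ordered (finite, nonempty) vertex set with smallest element $r$, and let $G$ be a connected graph on $V$. The function \[ f(R)=\bigcup_{v\in V-\{r\}}\{\min(J(v,R)\cap G)\} \] is a bijection from the set of increasing $G$-connected trees $R$ on $V$ to the set of broken circuit free subtrees $T$ of $G$, and its inverse is $f^{-1}(T)=k(T)$.
   Context: All graphs are finite labeled simple graphs; a graph on $V$ is identified with its edge set. A subgraph of $G$ has the same vertex set as $G$ and a subset of its edges; a subtree of $G$ is a subgraph of $G$ (on all of $V$) that is a tree. $G|_S$ is the restriction (induced subgraph) of $G$ to $S\subseteq V$. For a graph $G$ on $V$, $s(G)$ is the set partition of $V$ in which two vertices are in the same block if and only if they are joined by a path in $G$. If $G$ is a connected graph on $V$ rooted at $r$, its depth-first partition is the set partition $s(G|_{V-\{r\}})$ of $V-\{r\}$. For a rooted tree $R$ on $V$: $w$ is a descendant of $v$ if $v$ lies on the unique path from the root to $w$ (so $v$ is a descendant of itself); $\mathrm{des}(v,R)$ is the set of descendants of $v$; for $v$ not the root, $\mathrm{parent}(v,R)$ is the closest vertex to $v$ that is not a descendant of $v$. A rooted tree on a totally ordered vertex set $V$ is increasing if $v\le w$ for all $v\in V$ and $w\in\mathrm{des}(v,R)$; its root is then the smallest element of $V$. For $v$ not the root, $J(v,R)$ is the set of all possible edges joining $\mathrm{parent}(v,R)$ to an element of $\mathrm{des}(v,R)$. $R$ is $G$-connected if $J(v,R)\cap G\ne\emptyset$ for every non-root vertex $v$. ($R$ need not be a subgraph of $G$.) Edges are ordered lexicographically from the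 order on $V$ (an edge with ends $a<b$ is regarded as the pair $(a,b)$); minima of edge sets are taken in this order. A broken circuit of a subgraph $H\subseteq G$ is a set of edges $B\subseteq H$ such that there is an edge $e\in G$, smaller than every edge of $B$, with $B\cup\{e\}$ a circuit. $H$ is broken circuit free if it contains no broken circuits. For a connected graph $Q$ on a totally ordered vertex set $V$, the increasing tree $k(Q)$ on $V$, rooted at the smallest element of $V$, is defined by the following algorithm. Step 1: let $H$ be the empty (edgeless) graph on $V$ and set $S=V$. Step 2: let $r$ be the smallest vertex in $S$, and let $\pi$ be the depth-first partition of $Q|_S$ rooted at $r$; add to $H$ the edges connecting $r$ to the smallest vertex of each block of $\pi$ (whether or not these are edges of $Q$). Step 3: for each block $\pi_i$ of $\pi$ with more than one element, return to Step 2 with $S=\pi_i$. Step 4: return $k(Q)=H$. *)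

(* Defs.v *)
From HB Require Import structures.
From mathcomp Require Import all_boot all_order.
Set Implicit Arguments.
Unset Strict Implicit.
Unset Printing Implicit Defensive.
Import Order.Theory.
Local Open Scope order_scope.

(* Edges of the complete graph on V, ordered lexicographically through
   their pair of ends (a, b) with a < b. *)
Record edge {d} (V : finOrderType d) :=
  Edge { ends : V *l V; _ : ends.1 < ends.2 }.

Fact edge_display : Order.disp_t. Proof. exact: Order.Disp tt tt. Qed.

HB.instance Definition _ d (V : finOrderType d) := [isSub for @ends d V].
HB.instance Definition _ d (V : finOrderType d) := [Finite of edge V by <:].
HB.instance Definition _ d (V : finOrderType d) :=
  [SubChoice_isSubOrder of edge V by <: with edge_display].

Notation graph V := {set edge V}.

(* {min A} if A is nonempty, and set0 otherwise. *)
Definition minima d (T : finOrderType d) (A : {set T}) : {set T} :=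
  [set x in A | [forall y in A, x <= y]].

Section Graphs.
Context {d : Order.disp_t} {V : finOrderType d}.
Implicit Types (e : edge V) (E G H R T Q B C : graph V) (S : {set V}).
Implicit Types (x y v w r : V).

Definition joins e x y : bool := (ends e == (x, y)) || (ends e == (y, x)).

Definition adj E : rel V := fun x y => [exists e in E, joins e x y].

Definition restrict E S : graph V :=
  [set e in E | ((ends e).1 \in S) && ((ends e).2 \in S)].

(* The partition s(E|_S) of S. *)
Definition components E S : {set {set V}} :=
  equivalence_partition (connect (adj (restrict E S))) S.

Definition depth_first_partition Q S r : {set {set V}} :=
  components (restrict Q S) (S :\ r).

Definition connected E : bool := [forall x, forall y, connect (adj E) x y].

Definition cycle_edges (c : seq V) : graph V :=
  [set e | [exists x in c, joins e x (next c x)]].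

(* A list of distinct vertices has at most #|V| elements, so that bounded
   sequences reach all the cycles, and below all the simple paths, of E. *)
Definition circuit C : bool :=
  [exists c : #|V|.-bseq V,
    [&& (2 < size c)%N, uniq c & C == cycle_edges c]].

Definition tree E : bool :=
  connected E && [forall C : graph V, (C \subset E) ==> ~~ circuit C].

Definition subtree G E : bool := (E \subset G) && tree E.

(* Below, R is a tree rooted at r. *)
Definition des r R v : {set V} :=
  [set w | [exists p : #|V|.-bseq V,
    [&& path (adj R) r p, uniq (r :: p), last r p == w & v \in r :: p]]].

(* The least length of a path from x to y, or #|V| if there is none. *)
Definition dist E x y : nat :=
  find (fun n => [exists p : n.-tuple V, path (adj E) x p && (last x p == y)])
       (iota 0 #|V|).

(* For v different from r, the root r is not a descendant of v, so that the
   minimum is taken over a nonempty set; parent r R r is meaningless. *)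
Definition parent r R v : V :=
  [arg min_(u < r | u \notin des r R v) dist R v u]%N.

Definition increasing r R : bool :=
  [forall v, forall w in des r R v, v <= w].

Definition J r R v : graph V :=
  [set e | [exists w in des r R v, joins e (parent r R v) w]].

Definition Gconnected G r R : bool :=
  [forall v, (v != r) ==> (J r R v :&: G != set0)].

Definition increasing_trees G r : {set graph V} :=
  [set R | [&& tree R, increasing r R & Gconnected G r R]].

Definition broken_circuit G B : bool :=
  [exists e in G, [forall b in B, e < b] && circuit (e |: B)].

Definition broken_circuit_free G H : bool :=
  [forall B : graph V, (B \subset H) ==> ~~ broken_circuit G B].

Definition bcf_subtrees G : {set graph V} :=
  [set T | subtree G T && broken_circuit_free G T].

Definition f G r R : graph V :=
  \bigcup_(v | v != r) minima (J r R v :&: G).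

(* Each recursive call is on a smaller set S, so that n = #|S| is enough for
   the recursion bound n never to be reached. *)
Fixpoint k_rec n Q S : graph V :=
  if n isn't n'.+1 then set0 else
  \bigcup_(r in minima S)
    ([set e | [exists B in depth_first_partition Q S r,
                 [exists x in minima B, joins e r x]]]
     :|: \bigcup_(B in depth_first_partition Q S r | (1 < #|B|)%N)
           k_rec n' Q B).

Definition k Q : graph V := k_rec #|V| Q [set: V].

End Graphs.

(* Main.v *)
Require Import Defs.
From mathcomp Require Import all_boot all_order.

(** The theorem becomes transparent once an increasing tree and the recursion
    [k] are both read off from one relation. For a graph [Q], let [desc Q v]
    be the set of the vertices that are joined to [v] by a path of [Q] all of
    whose vertices are at least [v]; such a path is said below to run above
    [v], and strictly above [v] if it avoids [v] itself. These sets are laminar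
    ([desc_laminar]), so that each [v] other than the least vertex has a
    parent: the largest [p < v] with [v] in [desc Q p] (relation [child]).
    This is the elimination tree of [Q], and it is what [k] computes: the
    blocks of the depth-first partition of [desc Q p] are the sets [desc Q v]
    for the children [v] of [p] ([depth_first_partitionP]). If [R] is itself
    an increasing tree, [desc R v] is its set of descendants of [v]
    ([des_desc]), and [R] is its own elimination tree
    ([elimination_tree_increasing]).

    Both maps are now instances of one construction. Let [least_edges Q G]
    consist, for each child [v] of [p], of the least edge of [G] from [p] to
    [desc Q v]. Then [f G r R] is [least_edges R G] ([f_least_edges]) and
    [k Q] is [least_edges Q setT] ([k_least_edges]), since among all possible
    edges the least one from [p] to [desc Q v] ends at [v], the minimum of
    [desc Q v]. If [G] has an edge from [p] to [desc Q v] for each child [v]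
    of [p] (condition [meets]; for an increasing tree [Q] it says that [Q] is
    [G]-connected, and it holds if [Q] is contained in [G]), the construction
    has the first two of the following properties.
    - It preserves the sets [desc] ([desc_least_edges]). As [least_edges Q G]
      depends on [Q] through these sets only, [k (f R) = k R = R].
    - It is broken circuit free, hence acyclic ([least_edges_bcf]). In a
      circuit with least vertex [p], let [x < y] be the two neighbours of
      [p]; the least edge is [px], and [x], [y] are joined strictly above [p],
      so they are in [desc Q v] for the same child [v] of [p]. So [py] is not
      the least edge of [G] from [p] to [desc Q v] if [px] is in [G].
    - If [T] is a broken circuit free subgraph of [G], then [least_edges T G]
      is contained in [T] ([bcf_least_edges]): some edge of [T] joins [p] to
      [desc T v], and a smaller edge of [G] doing so would close a path of
      [T] with larger edges. If [T] is a tree, a connected subgraph of it is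
      [T] itself, whence [f (k T) = T]. *)

Set Implicit Arguments.
Unset Strict Implicit.
Unset Printing Implicit Defensive.
Import Order.Theory.
Local Open Scope order_scope.

(** * Invariants along paths, and extrema *)

(** Replaces the induction on a path in most of the reachability proofs
    below. *)
Lemma connect_invariant (T : finType) (e : rel T) (P : pred T) x y :
  connect e x y -> P x -> (forall a b, P a -> e a b -> P b) -> P y.
Proof.
move=> /connectP[p pth ->] Px cl.
elim: p x pth Px => //= z p IH x /andP[exz pth] Px.
by apply: IH pth _; apply: cl exz.
Qed.

Lemma connect_sub_rel (T : finType) (e e' : rel T) :
  (forall a b, e a b -> e' a b) -> subrel (connect e) (connect e').
Proof. by move=> s; apply: connect_sub => a b /s /connect1. Qed.

Section Min.
Context {d : Order.disp_t} {T : finOrderType d}.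

Lemma ex_min (P : pred T) x : P x ->
  exists2 m, P m & forall y, P y -> m <= y.
Proof.
by move=> Px; case: (Order.TotalTheory.arg_minP id Px) => m ? ?; exists m.
Qed.

Lemma ex_max (P : pred T) x : P x ->
  exists2 m, P m & forall y, P y -> y <= m.
Proof.
by move=> Px; case: (Order.TotalTheory.arg_maxP id Px) => m ? ?; exists m.
Qed.

Lemma minimaP (A : {set T}) x :
  reflect (x \in A /\ forall y, y \in A -> x <= y) (x \in minima A).
Proof.
rewrite inE; apply: (iffP andP) => -[xA h]; split=> //.
  by move=> y yA; move/forall_inP: h => /(_ y yA).
by apply/forall_inP.
Qed.

Lemma minima_unique (A : {set T}) x y :
  x \in minima A -> y \in minima A -> x = y.
Proof.
move=> /minimaP[xA hx] /minimaP[yA hy]; apply/le_anti.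
by rewrite hx ?hy.
Qed.

Lemma ex_minima (A : {set T}) : A != set0 -> exists x, x \in minima A.
Proof.
case/set0Pn=> x /ex_min[m mA hm]; exists m; exact/minimaP.
Qed.
End Min.

(** * Edges and adjacency *)

Section Edges.
Context {d : Order.disp_t} {V : finOrderType d}.
Implicit Types (e : edge V) (E G H R T Q C : graph V) (S B : {set V}).
Implicit Types (x y v w r p s : V).

Lemma joinsC e x y : joins e x y = joins e y x.
Proof. by rewrite /joins orbC. Qed.

Lemma ends_lt e : (ends e).1 < (ends e).2.
Proof. by case: e. Qed.

Lemma joins_ends e : joins e (ends e).1 (ends e).2.
Proof. by rewrite /joins -surjective_pairing eqxx. Qed.

Lemma joins_lt e x y : x < y -> joins e x y = (ends e == (x, y)).
Proof.
move=> xy; rewrite /joins.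
case: (ends e =P (y, x)) => [eE|]; last by rewrite orbF.
by have := ends_lt e; rewrite eE /= ltNge (ltW xy).
Qed.

Lemma joins_neq e x y : joins e x y -> x != y.
Proof.
by have := ends_lt e; rewrite /joins => lt /orP[]/eqP eE; move: lt;
  rewrite eE /= lt_neqAle => /andP[]; rewrite // eq_sym.
Qed.

Lemma joins_inj e e' x y : joins e x y -> joins e' x y -> e = e'.
Proof.
move=> j j'; apply: val_inj => /=; have := joins_neq j.
rewrite neq_lt => /orP[] lt.
  by move: j j'; rewrite !joins_lt // => /eqP-> /eqP->.
by move: j j'; rewrite !(joinsC _ x) !joins_lt // => /eqP-> /eqP->.
Qed.

Lemma ex_joins x y : x != y -> exists e, joins e x y.
Proof.
rewrite neq_lt => /orP[] lt.
  by exists (@Edge _ V (x, y) lt); rewrite /joins eqxx.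
by exists (@Edge _ V (y, x) lt); rewrite /joins eqxx orbT.
Qed.

Lemma edge_le e e' : (e <= e') =
  ((ends e).1 <= (ends e').1) &&
  (((ends e').1 <= (ends e).1) ==> ((ends e).2 <= (ends e').2)).
Proof. by []. Qed.

Lemma edge_lt1 e e' : (ends e).1 < (ends e').1 -> e < e'.
Proof. by move=> h; rewrite ltNge edge_le [_ <= _]leNgt h. Qed.

Lemma edge_le_joins e e' p x y :
  p < x -> p < y -> joins e p x -> joins e' p y -> (e <= e') = (x <= y).
Proof.
move=> px py; rewrite !joins_lt // => /eqP jx /eqP jy.
by rewrite edge_le jx jy /= lexx.
Qed.

Lemma adjP E x y : reflect (exists2 e, e \in E & joins e x y) (adj E x y).
Proof. exact: exists_inP. Qed.

Lemma adjC E x y : adj E x y = adj E y x.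
Proof. by apply/adjP/adjP => -[e eE j]; exists e; rewrite // joinsC. Qed.

Lemma adj_csym E : connect_sym (adj E).
Proof. by apply: sym_connect_sym => x y; apply: adjC. Qed.

Lemma adj_sub E H : E \subset H -> subrel (adj E) (adj H).
Proof. by move=> /subsetP s x y /adjP[e /s eH j]; apply/adjP; exists e. Qed.

Lemma adj_neq E x y : adj E x y -> x != y.
Proof. by move=> /adjP[e _ /joins_neq]. Qed.

Lemma restrictE E S e x y : joins e x y ->
  (e \in restrict E S) = [&& e \in E, x \in S & y \in S].
Proof. by rewrite inE => /orP[]/eqP-> //=; rewrite [(x \in S) && _]andbC. Qed.

Lemma adj_restrict E S x y :
  adj (restrict E S) x y = [&& adj E x y, x \in S & y \in S].
Proof.
apply/adjP/idP => [[e + j]|/andP[/adjP[e eE j] xyS]].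
  rewrite (restrictE _ _ j) => /andP[eE ->]; rewrite andbT.
  by apply/adjP; exists e.
by exists e; rewrite // (restrictE _ _ j) eE.
Qed.

Lemma adj_restrict_set E (P : pred V) x y :
  adj (restrict E [set u | P u]) x y = [&& adj E x y, P x & P y].
Proof. by rewrite adj_restrict !inE. Qed.

Lemma restrict_sub E S : restrict E S \subset E.
Proof. by apply/subsetP => e; rewrite inE => /andP[]. Qed.

Lemma connect_graph_sub E H :
  E \subset H -> subrel (connect (adj E)) (connect (adj H)).
Proof. by move=> /adj_sub s; apply: connect_sub_rel. Qed.

Lemma connect_path E S x (q : seq V) :
  path (adj E) x q -> {subset x :: q <= S} ->
  connect (adj (restrict E S)) x (last x q).
Proof.
move=> pth sS; apply/connectP; exists q => //.
elim: q x pth sS => //= y q IH x /andP[xy pth] sS.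
rewrite adj_restrict xy !sS ?inE ?eqxx ?orbT //= IH // => z zp.
by apply: sS; rewrite inE zp orbT.
Qed.

End Edges.

(** * Circuits *)

Section Circuits.
Context {d : Order.disp_t} {V : finOrderType d}.
Implicit Types (e : edge V) (E G H R T Q C : graph V) (S B : {set V}).
Implicit Types (x y v w r p s : V).

Lemma uniq_bseq (s : seq V) : uniq s -> (size s <= #|V|)%N.
Proof. by move/card_uniqP <-; apply: max_card. Qed.

(** An edge outside [E] with ends joined in [E] closes a circuit: a simple path
    between its ends has an inner vertex, since the edge itself is not in
    [E]. *)
Lemma connected_circuit E e :
  e \notin E -> connect (adj E) (ends e).1 (ends e).2 ->
  exists2 C : graph V, circuit C & (e \in C) && (C \subset e |: E).
Proof.
set a := (ends e).1; set b := (ends e).2 => eE.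
case/connectP=> q /shortenP[p pth up _] bE {q}.
have us := uniq_bseq up.
have jab : joins e a b by apply: joins_ends.
have bl : b = last a p by [].
exists (cycle_edges (a :: p)).
  apply/existsP; exists (Bseq us); rewrite eqxx up !andbT /=.
  case: p pth bl {up us bE} => [_ ab|y [|//]].
    by have := joins_neq jab; rewrite ab /= eqxx.
  rewrite /= andbT => /adjP[e' e'E j] yb; move: eE; rewrite yb in jab.
  by rewrite (joins_inj jab j) e'E.
have nb : next (a :: p) b = a.
  by rewrite bl next_nth mem_last index_last // nth_default.
apply/andP; split.
  rewrite inE; apply/exists_inP; exists b; first by rewrite bl mem_last.
  by rewrite nb joinsC.
have cyc : cycle (adj (e |: E)) (a :: p).
  rewrite /= rcons_path -bl (sub_path (adj_sub (subsetU1 e E)) pth) /=.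
  by apply/adjP; exists e; rewrite ?setU11 // joinsC.
apply/subsetP=> e'; rewrite inE => /exists_inP[x xp j].
have /adjP[e2 e2E j2] := next_cycle cyc xp.
by rewrite (joins_inj j j2).
Qed.

(** The anatomy of a circuit around its least vertex [p]: the two neighbours of
    [p] on it are [x] and [y], the rest of the circuit joins them strictly
    above [p], and the smaller of the two edges at [p] is the least edge of
    all, because the other edges have a larger lower end. *)
Lemma circuit_min C : circuit C ->
  exists p x y e1 e2, [/\ p < x, x < y,
    [/\ e1 \in C, joins e1 p x & forall e, e \in C -> e1 <= e],
    e2 \in C /\ joins e2 p y &
    connect (adj (restrict C [set u | p < u])) x y].
Proof.
case/existsP=> -[c /= _] /and3P[sc uc /eqP CE].
have [p0 p0c] : exists p0, p0 \in c.
  by case: c sc {uc CE} => // a l; exists a; rewrite inE eqxx.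
have [p pc pmin] := @ex_min _ V [in c] p0 p0c.
have yc : prev c p \in c by rewrite mem_prev.
(* Rotate the circuit so that it reads y, p, x, ... with p the least vertex. *)
have [i s cE] := rot_to yc.
have us : uniq (prev c p :: s) by rewrite -cE rot_uniq.
have ss : (2 < size (prev c p :: s))%N by rewrite -cE size_rot.
have nx z : next (prev c p :: s) z = next c z by rewrite -cE next_rot.
have mc : c =i prev c p :: s by move=> z; rewrite -cE mem_rot.
have {CE} CE : C = cycle_edges (prev c p :: s).
  apply/setP=> e; rewrite CE !inE; apply/exists_inP/exists_inP => -[z zc j];
    exists z; by [rewrite -mc | rewrite nx | rewrite mc | rewrite -nx].
have := nx (prev c p); rewrite next_prev //.
move: (prev c p) us ss mc CE => y us ss mc CE {cE sc i uc nx p0c yc}.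
case: s us ss mc CE => [|p' [|x s]] //= us _ mc CE; rewrite eqxx => pE.
subst p'.
have uc : uniq [:: y, p, x & s] := us.
case/and4P: us; rewrite !inE !negb_or => /and3P[yp yx ys] /andP[px ps] xs us'.
have pminc z : z \in [:: y, p, x & s] -> z != p -> p < z.
  by move=> zc zp; rewrite lt_neqAle eq_sym zp pmin ?mc.
have cyc : cycle (adj C) [:: y, p, x & s].
  apply: cycle_from_next => // z zc.
  have [j l lE] := rot_to zc.
  have [e je] : exists e, joins e z (next [:: y, p, x & s] z).
    apply: ex_joins.
    rewrite -(next_rot j) // lE; have : uniq (z :: l) by rewrite -lE rot_uniq.
    have : size (z :: l) = (size s).+3 by rewrite -lE size_rot.
    case: l {lE} => [|z' l] //= _; rewrite eqxx inE negb_or.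
    by move=> /andP[/andP[]].
  by apply/adjP; exists e; rewrite // CE inE; apply/exists_inP; exists z.
have lpx : p < x by apply: pminc; rewrite ?inE ?eqxx ?orbT // eq_sym.
have lpy : p < y by apply: pminc; rewrite ?inE ?eqxx ?orbT.
case/and3P: (cyc) => /adjP[ey eyC jy] /adjP[ex exC jx] pth.
have con : connect (adj (restrict C [set u | p < u])) x y.
  have <- : last x (rcons s y) = y by rewrite last_rcons.
  apply: connect_path => // z; rewrite in_cons mem_rcons in_cons inE => zc.
  apply: pminc; first by rewrite !inE; case/or3P: zc => ->; rewrite ?orbT.
  case/or3P: zc => [/eqP->|/eqP->|zs //]; rewrite // 1?eq_sym //.
  by apply: contraNneq ps => ->.
(* The edges of the circuit at p are those to its two neighbours. *)
have low e : e \in C -> [\/ p < (ends e).1, e = ex | e = ey].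
  rewrite CE inE => /exists_inP[z zc j].
  have nzc : next [:: y, p, x & s] z \in [:: y, p, x & s] by rewrite mem_next.
  have [zp|zp] := eqVneq z p.
    constructor 2; apply: joins_inj jx; move: j.
    by rewrite zp /= [p == y]eq_sym (negPf yp) eqxx.
  have [nzp|nzp] := eqVneq (next [:: y, p, x & s] z) p.
    have zy : z = y by apply: (can_inj (prev_next uc)); rewrite nzp /= eqxx.
    by constructor 3; apply: joins_inj jy; rewrite -zy -nzp.
  constructor 1; move: j; rewrite /joins => /orP[]/eqP-> /=; exact: pminc.
have lowp e q z : p < q -> joins e p q -> p < (ends z).1 -> e <= z.
  move=> pq; rewrite joins_lt // => /eqP je pz; apply: ltW; apply: edge_lt1.
  by rewrite je.
rewrite joinsC in jy.
have: x != y by rewrite eq_sym.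
rewrite neq_lt => /orP[] xy.
  exists p, x, y, ex, ey; split=> //; split=> // e /low[?|->|->] //.
    exact: lowp jx _.
  by rewrite (edge_le_joins lpx lpy) // ltW.
exists p, y, x, ey, ex; split=> //; last by rewrite adj_csym.
split=> // e /low[?|->|->] //; first exact: lowp jy _.
by rewrite (edge_le_joins lpy lpx) // ltW.
Qed.

End Circuits.

(** * The descendant order of a graph *)

Section Descendants.
Context {d : Order.disp_t} {V : finOrderType d}.
Implicit Types (e : edge V) (E G H R T Q C : graph V) (S B : {set V}).
Implicit Types (x y v w r p s : V).

(** For an increasing tree these are the descendants of [v]; in general they
    are the descendants of [v] in the elimination tree of [Q]. *)
Definition desc Q v : {set V} :=
  [set w | connect (adj (restrict Q [set u | v <= u])) v w].

Lemma desc_refl Q v : v \in desc Q v.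
Proof. by rewrite inE connect0. Qed.

Lemma desc_le Q v w : w \in desc Q v -> v <= w.
Proof.
rewrite inE => /(@connect_invariant _ _ (fun u => v <= u)); apply=> // a b _.
by rewrite adj_restrict_set => /and3P[].
Qed.

Lemma desc_sub Q v w : w \in desc Q v -> desc Q w \subset desc Q v.
Proof.
move=> wv; apply/subsetP => u; move: (wv); rewrite !inE => vw wu.
apply: connect_trans vw _; apply: connect_sub_rel wu => a b.
rewrite !adj_restrict_set => /and3P[-> wa wb].
by rewrite !(le_trans (desc_le wv)).
Qed.

Lemma desc_trans Q v w u : w \in desc Q v -> u \in desc Q w -> u \in desc Q v.
Proof. by move=> /desc_sub /subsetP; apply. Qed.

(** Through [u], a path above [v] can be continued by a path above [w]. *)
Lemma desc_laminar Q u v w :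
  u \in desc Q v -> u \in desc Q w -> v <= w -> w \in desc Q v.
Proof.
move=> uv uw vw; move: uv uw; rewrite !inE => vu wu.
apply: connect_trans vu _; rewrite adj_csym.
apply: connect_sub_rel wu => a b.
by rewrite !adj_restrict_set => /and3P[-> wa wb]; rewrite !(le_trans vw).
Qed.

Lemma desc_adj Q v w u :
  w \in desc Q v -> adj Q w u -> v <= u -> u \in desc Q v.
Proof.
move=> wv a vu; have vw := desc_le wv.
move: wv; rewrite !inE => cvw; apply: connect_trans cvw _.
by rewrite connect1 // adj_restrict_set a vw.
Qed.

(** A variant of [connect_invariant] in which each step may use that its origin
    is already known to be in [desc Q v]. *)
Lemma desc_invariant Q v w (P : pred V) : w \in desc Q v -> P v ->
  (forall a b, a \in desc Q v -> P a -> adj Q a b -> v <= b -> P b) -> P w.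
Proof.
rewrite inE => vw Pv st.
suff /andP[] : (w \in desc Q v) && P w by [].
apply: (connect_invariant vw (P := fun u => (u \in desc Q v) && P u)).
  by rewrite desc_refl.
move=> a b /andP[av Pa]; rewrite adj_restrict_set.
by move=> /and3P[ab _ vb]; rewrite (desc_adj av ab vb) (st a).
Qed.

Lemma desc_restrict Q v w :
  w \in desc Q v -> connect (adj (restrict Q (desc Q v))) v w.
Proof.
move=> wv; apply: (desc_invariant wv (P := connect _ v)) => // a b av va ab vb.
apply: connect_trans va _.
by rewrite connect1 // adj_restrict ab av (desc_adj av ab vb).
Qed.

Lemma desc_root Q r : (forall v, r <= v) -> connected Q -> desc Q r = setT.
Proof.
move=> hr /forallP/(_ r)/forallP cQ; apply/setP=> w; rewrite !inE.
apply: connect_sub_rel (cQ w) => a b ab.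
by rewrite adj_restrict ab !inE !hr.
Qed.

(** The elements [q] with [v] in [desc Q q] form a chain, of which the parent is
    the largest element below [v]. *)
Definition child Q p v : bool :=
  [&& p < v, v \in desc Q p &
      [forall q, (q < v) && (v \in desc Q q) ==> (q <= p)]].

Lemma childP Q p v :
  reflect [/\ p < v, v \in desc Q p &
             forall q, q < v -> v \in desc Q q -> q <= p]
    (child Q p v).
Proof.
apply: (iffP and3P) => -[pv vp h]; split=> //.
  by move=> q qv vq; move/forallP/(_ q): h; rewrite qv vq.
by apply/forallP => q; apply/implyP => /andP[]; apply: h.
Qed.

Lemma child_lt Q p v : child Q p v -> p < v.
Proof. by case/childP. Qed.

Lemma child_desc Q p v : child Q p v -> v \in desc Q p.
Proof. by case/childP. Qed.

Lemma child_sub Q p v w : child Q p v -> w \in desc Q v -> w \in desc Q p.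
Proof. by move=> /child_desc; apply: desc_trans. Qed.

Lemma child_le Q p v w : child Q p v -> w \in desc Q v -> p < w.
Proof. by move=> /child_lt pv /desc_le; apply: lt_le_trans. Qed.

Lemma child_unique Q p p' v : child Q p v -> child Q p' v -> p = p'.
Proof.
move=> /childP[pv vp h] /childP[pv' vp' h'].
by apply/le_anti; rewrite h ?h'.
Qed.

Lemma ex_parent Q a v : v \in desc Q a -> a < v -> exists p, child Q p v.
Proof.
move=> va av; pose P q := (q < v) && (v \in desc Q q).
have [|p /andP[pv vp] h] := @ex_max _ V P a; first by rewrite /P av.
by exists p; apply/childP; split=> // q qv vq; apply: h; apply/andP.
Qed.

(** The child is the least element greater than [a] of the chain of those [u] in
    [desc Q a] for which [w] is in [desc Q u]. *)
Lemma ex_child Q a w : w \in desc Q a -> a < w ->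
  exists2 v, child Q a v & w \in desc Q v.
Proof.
move=> wa aw; pose P u := [&& a < u, w \in desc Q u & u \in desc Q a].
have [|v /and3P[av wv va] h] := @ex_min _ V P w.
  by rewrite /P aw desc_refl.
exists v => //; apply/childP; split=> // q qv vq; rewrite leNgt.
apply/negP => aq; have := qv; rewrite ltNge h // /P aq (desc_trans vq wv).
by rewrite (desc_laminar va vq) // ltW.
Qed.

(** Moving strictly above [p], one cannot leave the subtree of a child [v] of
    [p]: if the new vertex [y] is below [v], then [v] is in [desc Q y], against
    the choice of [p] as the parent of [v]. *)
Lemma child_step Q p v x y :
  child Q p v -> x \in desc Q v -> adj Q x y -> p < y -> y \in desc Q v.
Proof.
move=> /childP[pv vp h] xv xy py.
have [vy|yv] := leP v y; first exact: desc_adj xy vy.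
have yx : y <= x by apply: le_trans (ltW yv) (desc_le xv).
have xy' : x \in desc Q y by apply: desc_adj (desc_refl _ _) _ yx; rewrite adjC.
have := h y yv (desc_laminar xy' xv (ltW yv)).
by rewrite leNgt py.
Qed.

Lemma child_same Q p v x y : child Q p v -> x \in desc Q v ->
  connect (adj (restrict Q [set u | p < u])) x y -> y \in desc Q v.
Proof.
move=> ch xv /(@connect_invariant _ _ [in desc Q v]); apply=> // a b av.
by rewrite adj_restrict_set => /and3P[ab _]; apply: child_step ch _ ab.
Qed.

(** A path of [Q] from [v] to [p] above [p] must leave [desc Q v], and by
    [child_step] it can do so only by a step to [p]. *)
Lemma child_adj Q p v : child Q p v -> exists2 x, x \in desc Q v & adj Q p x.
Proof.
move=> ch; apply/exists_inP; apply: contraT => /exists_inPn no.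
have pv := child_lt ch.
suff : p \in desc Q v by move/desc_le; rewrite leNgt pv.
have := child_desc ch; rewrite inE adj_csym.
move/(@connect_invariant _ _ [in desc Q v]); apply; first exact: desc_refl.
move=> a b av; rewrite adj_restrict_set => /and3P[ab _].
rewrite le_eqVlt => /orP[/eqP pb|]; last exact: child_step ch av ab.
by move: (no a av); rewrite pb adjC ab.
Qed.

(** * Trees made of least edges *)

Definition star p S : graph V := [set e | [exists w in S, joins e p w]].

Lemma starP p S e : reflect (exists2 w, w \in S & joins e p w) (e \in star p S).
Proof. by rewrite inE; apply: exists_inP. Qed.

(** The common form of [f], where [Q] is the tree, and of [k], where [G] is the
    complete graph. *)
Definition least_edges Q G : graph V :=
  [set e | [exists p, exists v,
     child Q p v && (e \in minima (star p (desc Q v) :&: G))]].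

Lemma least_edgesP Q G e :
  reflect (exists p v w, [/\ child Q p v, w \in desc Q v, joins e p w, e \in G &
     forall e' w', w' \in desc Q v -> joins e' p w' -> e' \in G -> e <= e'])
  (e \in least_edges Q G).
Proof.
rewrite inE; apply: (iffP existsP).
  move=> [p /existsP[v /andP[ch /minimaP[]]]]; rewrite inE.
  move=> /andP[/starP[w wv j] eG] h; exists p, v, w.
  split=> // e' w' wv' j' eG'.
  by apply: h; rewrite inE eG' andbT; apply/starP; exists w'.
move=> [p [v [w [ch wv j eG h]]]]; exists p; apply/existsP; exists v.
rewrite ch; apply/minimaP; rewrite inE eG andbT; split.
  by apply/starP; exists w.
by move=> e'; rewrite inE => /andP[/starP[w' wv' j'] eG']; apply: h wv' j' eG'.
Qed.

Lemma least_edges_sub Q G : least_edges Q G \subset G.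
Proof. by apply/subsetP => e /least_edgesP[p [v [w []]]]. Qed.

(** For an increasing tree [Q] this is being [G]-connected. *)
Definition meets Q G :=
  forall p v, child Q p v -> star p (desc Q v) :&: G != set0.

Lemma meets_sub Q G : Q \subset G -> meets Q G.
Proof.
move=> /subsetP QG p v /child_adj[x xv /adjP[e /QG eG j]].
by apply/set0Pn; exists e; rewrite inE eG andbT; apply/starP; exists x.
Qed.

Lemma meets_setT Q : meets Q setT.
Proof. exact/meets_sub/subsetT. Qed.

(** Every new edge goes from some [p] to an element of [desc Q p], so that no
    new vertex becomes reachable. Conversely [v] still reaches the
    subtree of each of its children, and the subtree of a child remains
    connected by induction on its size. *)
Lemma desc_least_edges Q G v : meets Q G -> desc (least_edges Q G) v = desc Q v.
Proof.
move=> mQ; apply/eqP; rewrite eqEsubset; apply/andP; split; apply/subsetP.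
  move=> w /(@desc_invariant _ _ _ [in desc Q v]); apply.
    exact: desc_refl.
  move=> a b _ /= av /adjP[e /least_edgesP[p [c [x [ch xc j _ _]]]] j'] vb.
  have xp := child_sub ch xc; have lpx := child_le ch xc.
  move: j j'; rewrite joins_lt // => /eqP eE; rewrite /joins eE.
  case/orP=> /eqP[pa xb].
    by rewrite -xb; apply: desc_trans xp; rewrite pa.
  by rewrite -pa; apply: desc_laminar (_ : x \in _) xp _; rewrite ?xb ?pa.
have [n] := ubnP #|desc Q v|; elim: n v => // n IH v lt w wv.
have := desc_le wv; rewrite le_eqVlt => /orP[/eqP<-|vw]; first exact: desc_refl.
have [c ch wc] := ex_child wv vw.
have {}IH : {subset desc Q c <= desc (least_edges Q G) c}.
  apply: IH; apply: leq_trans (ltnSE lt); apply: proper_card.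
  rewrite properE desc_sub ?(child_desc ch) //; apply/subsetPn; exists v.
    exact: desc_refl.
  by apply: contraL (child_lt ch) => /desc_le; rewrite leNgt.
have [e em] := ex_minima (mQ _ _ ch).
have eF : e \in least_edges Q G.
  by rewrite inE; apply/existsP; exists v; apply/existsP; exists c; rewrite ch.
have /minimaP[] := em; rewrite inE => /andP[/starP[x xc j] _] _.
have vx := child_le ch xc.
have xF : x \in desc (least_edges Q G) v.
  by apply: desc_adj (desc_refl _ _) _ (ltW vx); apply/adjP; exists e.
apply: desc_trans (IH _ wc).
by apply: desc_laminar xF (IH _ xc) (ltW (child_lt ch)).
Qed.

Lemma connected_desc Q r : desc Q r = setT -> connected Q.
Proof.
move=> rT; have c v : connect (adj Q) r v.
  have : v \in desc Q r by rewrite rT.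
  by rewrite inE; apply: connect_graph_sub; apply: restrict_sub.
apply/forallP=> a; apply/forallP=> b.
by rewrite (connect_trans _ (c b)) // adj_csym.
Qed.

Lemma connected_least_edges Q G r : (forall v, r <= v) -> connected Q ->
  meets Q G -> connected (least_edges Q G).
Proof.
move=> hr cQ mQ; apply: (@connected_desc _ r).
by rewrite desc_least_edges // desc_root.
Qed.

Lemma eq_child Q Q' : desc Q =1 desc Q' -> child Q =2 child Q'.
Proof.
move=> h p v; rewrite /child h; congr [&& _, _ & _].
by apply: eq_forallb => q; rewrite h.
Qed.

Lemma eq_least_edges Q Q' G :
  desc Q =1 desc Q' -> least_edges Q G = least_edges Q' G.
Proof.
move=> h; apply/setP=> e; rewrite [LHS]inE [RHS]inE; apply: eq_existsb => p.
by apply: eq_existsb => v; rewrite (eq_child h) h.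
Qed.

(** Let [e] be the least edge of a circuit made of [e] and [B], and [p] its
    least vertex. Then [e] is the smaller of the two edges at [p], and the
    other one, [e2], is among the least edges. But both lead from [p] to the
    subtree of the same child, because their upper ends are joined strictly
    above [p]. *)
Lemma least_edges_bcf Q G :
  meets Q G -> broken_circuit_free G (least_edges Q G).
Proof.
move=> mQ; apply/forallP => B; apply/implyP => /subsetP BF.
apply/negP => /exists_inP[e eG /andP[/forall_inP lt]].
case/circuit_min => p [x [y [e1 [e2 [px xy [e1C j1 m1] [e2C j2] con]]]]].
have e12 : e1 < e2.
  by rewrite ltNge (edge_le_joins (lt_trans px xy) px j2 j1) -ltNge.
have e1E : e1 = e.
  move: e1C; rewrite in_setU1 => /predU1P[//|/lt].
  by rewrite ltNge m1 // setU11.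
subst e1; have e2F : e2 \in least_edges Q G.
  apply: BF; move: e2C; rewrite in_setU1 => /predU1P[e2e|//].
  by move: e12; rewrite e2e ltxx.
have {}con : connect (adj (restrict (least_edges Q G) [set u | p < u])) x y.
  apply: connect_graph_sub con; apply/subsetP => b.
  rewrite inE in_setU1 => /andP[/predU1P[->|/BF bF] pb]; last by rewrite inE bF.
  by move: pb j1; rewrite joins_lt // inE => + /eqP eE; rewrite eE ltxx.
case/least_edgesP: e2F => p' [v [w [ch wv j _ m2]]].
have [? ?] : p' = p /\ w = y.
  have := lt_trans px xy; have := child_le ch wv => pw py.
  by move: j j2; rewrite !joins_lt // => /eqP-> /eqP[].
subst p' w; have D := desc_least_edges _ mQ.
suff xv : x \in desc Q v by have := m2 _ _ xv j1 eG; rewrite leNgt e12.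
rewrite -D; apply: (@child_same _ p _ y); rewrite ?(eq_child D) ?D //.
by rewrite adj_csym.
Qed.

(** A circuit without its least edge would be a broken circuit. *)
Lemma bcf_acyclic G H : H \subset G -> broken_circuit_free G H ->
  forall C : graph V, C \subset H -> ~~ circuit C.
Proof.
move=> /subsetP HG /forallP bcf C CH; apply/negP => cC.
have [p [x [y [e [_ [_ _ [eC _ me] _ _]]]]]] := circuit_min cC.
have := bcf (C :\ e); rewrite (subset_trans (subsetDl _ _) CH) /=; case/negP.
apply/exists_inP; exists e; first exact/HG/(subsetP CH).
rewrite setD1K // cC andbT; apply/forall_inP => b; rewrite !inE => /andP[be bC].
by rewrite lt_neqAle eq_sym be me.
Qed.

Lemma least_edges_subtree Q G r :
  (forall v, r <= v) -> connected Q -> meets Q G ->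
  subtree G (least_edges Q G).
Proof.
move=> hr cQ mQ.
rewrite /subtree /tree least_edges_sub (connected_least_edges hr) //=.
apply/forallP=> C; apply/implyP; apply: bcf_acyclic (least_edges_sub Q G) _ _.
exact: least_edges_bcf.
Qed.

Lemma connected_sub_tree E T :
  E \subset T -> connected E -> tree T -> E = T.
Proof.
move=> ET cE /andP[_ /forallP aT]; apply/eqP; rewrite eqEsubset ET /=.
apply/subsetP => e eT; apply: contraT => eE.
have [|C cC /andP[eC CE]] := connected_circuit eE.
  by move/forallP/(_ (ends e).1)/forallP: cE.
have := aT C; rewrite cC implybF => /negP[]; apply: subset_trans CE _.
by rewrite subUset sub1set eT.
Qed.

(** The least edge [e] of [G] from [p] to [desc T v] is in [T]: otherwise it
    closes a circuit with an edge [b] of [T] from [p] to [desc T v] and a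
    path of [T] above [v], all of which are larger than [e]. *)
Lemma bcf_least_edges T G : T \subset G -> broken_circuit_free G T ->
  least_edges T G \subset T.
Proof.
move=> /subsetP TG /forallP bcf; apply/subsetP => e /least_edgesP[p [v [w]]].
move=> [ch wv j eG me]; have [x xv /adjP[b bT jb]] := child_adj ch.
have [<- //|eb] := eqVneq b e.
have {}eb : e < b by rewrite lt_neqAle eq_sym eb (me b x) ?TG.
have pv := child_lt ch; have pw := child_le ch wv; have px := child_le ch xv.
pose H := b |: restrict T [set u | v <= u].
have eH h : h \in H -> (h \in T) && (e < h).
  rewrite in_setU1 => /predU1P[->|]; first by rewrite bT.
  rewrite !inE => /andP[-> /andP[vh _]] /=; apply: edge_lt1.
  by move: j; rewrite joins_lt // => /eqP-> /=; apply: lt_le_trans vh.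
have [||C cC /andP[eC CH]] := @connected_circuit _ _ H e.
- by apply/negP => /eH; rewrite ltxx andbF.
- have sH : restrict T [set u | v <= u] \subset H by apply: subsetU1.
  move: j; rewrite joins_lt // => /eqP-> /=.
  have vH u : u \in desc T v -> connect (adj H) v u.
    by rewrite inE; apply: connect_graph_sub sH _ _.
  apply: (@connect_trans _ _ x).
    by rewrite connect1 //; apply/adjP; exists b; rewrite ?setU11.
  by apply: (@connect_trans _ _ v); rewrite ?vH // adj_csym vH.
have CeH h : h \in C :\ e -> h \in H.
  by rewrite in_setD1 => /andP[/negPf he /(subsetP CH)]; rewrite in_setU1 he.
have sT : C :\ e \subset T by apply/subsetP => h /CeH /eH /andP[].
move/implyP: (bcf (C :\ e)) => /(_ sT)/negP[].
apply/exists_inP; exists e; rewrite // setD1K // cC andbT.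
by apply/forall_inP => h /CeH /eH /andP[].
Qed.

End Descendants.

(** * Increasing trees *)

Section IncreasingTrees.
Context {d : Order.disp_t} {V : finOrderType d}.
Implicit Types (e : edge V) (E G H R T Q C : graph V) (S B : {set V}).
Implicit Types (x y v w r p s : V).

Lemma path_restrict E S x (q : seq V) :
  path (adj (restrict E S)) x q -> path (adj E) x q /\ {subset q <= S}.
Proof.
elim: q x => //= y q IH x; rewrite adj_restrict.
case/andP=> /and3P[-> _ yS] /IH[-> sq]; split=> // z.
by rewrite inE => /predU1P[->|/sq].
Qed.

Lemma desP r R v w :
  reflect (exists q : seq V, [/\ path (adj R) r q, uniq (r :: q),
                                 last r q = w & v \in r :: q])
    (w \in des r R v).
Proof.
rewrite inE; apply: (iffP existsP).
  by case=> q /and4P[pq uq /eqP lq vq]; exists q.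
case=> q [pq uq lq vq].
have sq : (size q <= #|V|)%N by apply: uniq_bseq; case/andP: uq.
by exists (Bseq sq); apply/and4P; split=> //; apply/eqP.
Qed.

Lemma des_prefix r R (q1 q2 : seq V) v :
  path (adj R) r (q1 ++ q2) -> uniq (r :: q1 ++ q2) ->
  v \in r :: q1 -> last r q1 \in des r R v.
Proof.
rewrite cat_path -cat_cons cat_uniq => /andP[p1 _] /andP[u1 _] vq; apply/desP.
by exists q1.
Qed.

Lemma des_ancestors r R v : connected R ->
  exists q : seq V, [/\ path (adj R) r q, uniq (r :: q), last r q = v &
    forall u, u \in r :: q -> v \in des r R u].
Proof.
move=> /forallP/(_ r)/forallP/(_ v)/connectP[q0 /shortenP[q pq uq _] ->].
by exists q; split=> // u uq'; apply/desP; exists q.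
Qed.

Lemma increasing_le r R v w : increasing r R -> w \in des r R v -> v <= w.
Proof. by move=> /forallP/(_ v)/forall_inP; apply. Qed.

(** The vertices of a simple path from the root to [v] have [v] as a
    descendant, hence are at most [v]. *)
Lemma increasing_below r R v : connected R -> increasing r R ->
  connect (adj (restrict R [set u | u <= v])) r v.
Proof.
move=> cR iR; have [q [pq _ <- h]] := des_ancestors r v cR.
by apply: connect_path pq _ => u /h/(increasing_le iR); rewrite inE.
Qed.

(** The part from [v] on of a simple path from the root consists of descendants
    of [v], hence lies above [v]. Conversely, a simple path from the root to
    [v] stays below [v], so that it meets a simple path above [v] only in [v],
    and their concatenation is simple. *)
Lemma des_desc r R v : connected R -> increasing r R -> des r R v = desc R v.
Proof.
move=> cR iR; apply/eqP; rewrite eqEsubset.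
apply/andP; split; apply/subsetP => w.
  case/desP=> q [pq uq <- vq]; case/splitPl: vq pq uq => q1 q2 l1 pq uq.
  rewrite inE last_cat l1; apply: connect_path.
    by move: pq; rewrite cat_path l1 => /andP[].
  move=> u; rewrite inE inE => /predU1P[->|uq2]; first exact: lexx.
  case/splitPr: uq2 pq uq => q3 q4; rewrite -cat_rcons catA => pq uq.
  apply: (increasing_le iR); have := des_prefix pq uq (v := v).
  rewrite last_cat last_rcons; apply.
  by rewrite -cat_cons mem_cat -l1 mem_last.
rewrite inE => /connectP[q0 /shortenP[q2 + uq2 _] ->] {q0 w}.
move=> /path_restrict[pq2 ge2].
have [q [pq uq lq h]] := des_ancestors r v cR.
apply/desP; exists (q ++ q2); rewrite last_cat cat_path pq lq; split=> //.
  move: uq2; rewrite cons_uniq -cat_cons cat_uniq uq => /andP[vq2 ->].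
  rewrite andbT /=.
  apply: contra vq2 => /hasP[u uq2 uq'].
  suff -> : v = u by [].
  apply/le_anti; rewrite (increasing_le iR (h u uq')) andbT.
  by have := ge2 u uq2; rewrite inE.
by rewrite -cat_cons mem_cat -lq mem_last.
Qed.

(** Some edge of [R] joins [p] to an [x] in [desc R v]. If [v < x], then [p] and
    [v] are joined below [v] through the root, and [v] and [x] above [v],
    neither way using the edge [px]; this gives a circuit in [R]. *)
Lemma child_edge r R p v : tree R -> increasing r R -> child R p v ->
  exists2 e, e \in R & joins e p v.
Proof.
move=> /andP[cR /forallP aR] iR ch.
have [x xv /adjP[e eR j]] := child_adj ch.
have := desc_le xv; rewrite le_eqVlt => /orP[/eqP vx|vx].
  by exists e; rewrite // vx.
have pv := child_lt ch; have px := lt_trans pv vx.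
have jE : ends e = (p, x) by move: j; rewrite joins_lt // => /eqP.
have [||C cC /andP[_ CR]] := @connected_circuit _ _ (R :\ e) e.
- by rewrite !inE eqxx.
- rewrite jE /=.
  have s1 : restrict R [set u | u <= v] \subset R :\ e.
    apply/subsetP => b; rewrite inE in_setD1 => /and3P[-> _].
    by rewrite inE andbT; apply: contraTneq => ->; rewrite jE /= -ltNge.
  have s2 : restrict R [set u | v <= u] \subset R :\ e.
    apply/subsetP => b; rewrite inE in_setD1 => /and3P[-> + _].
    by rewrite inE andbT; apply: contraTneq => ->; rewrite jE /= -ltNge.
  apply: (@connect_trans _ _ v); last first.
    by apply: connect_graph_sub s2 _ _ _; move: xv; rewrite inE.
  have below u : u <= v -> connect (adj (R :\ e)) r u.
    move=> uv; apply: connect_graph_sub s1 _ _ _.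
    apply: connect_sub_rel (increasing_below u cR iR) => a b.
    by rewrite !adj_restrict_set => /and3P[-> au bu]; rewrite !(le_trans _ uv).
  apply: (@connect_trans _ _ r); [rewrite adj_csym|]; apply: below => //.
  exact: ltW.
by move: (aR C); rewrite cC implybF -(setD1K eR) CR.
Qed.

(** * Elimination trees *)

(** In the complete graph, the least edge from [p] to [desc Q v] is [pv]. *)
Lemma least_edges_setT Q e :
  reflect (exists p v, child Q p v /\ joins e p v) (e \in least_edges Q setT).
Proof.
apply: (iffP (least_edgesP _ _ _)) =>
    [[p [v [w [ch wv j _ m]]]]|[p [v [ch j]]]];
  exists p, v; have pv := child_lt ch.
  split=> //; have pw := child_le ch wv.
  have [e' j'] : exists e', joins e' p v by apply: ex_joins; rewrite lt_eqF.
  have := m e' v (desc_refl _ _) j' (in_setT _).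
  rewrite (edge_le_joins pw pv j j') => wv'.
  suff <- : w = v by [].
  by apply/le_anti; rewrite wv' (desc_le wv).
exists v; split=> //; [exact: desc_refl | exact: in_setT | ].
move=> e' w' w'v j' _; rewrite (edge_le_joins pv (child_le ch w'v) j j').
exact: desc_le w'v.
Qed.

Section Rooted.
Context (r : V) (hr : forall v, r <= v).

(** The edges between parents and children are in [R] and form a connected
    graph, so that they are all of the tree [R]. *)
Lemma elimination_tree_increasing R : tree R -> increasing r R ->
  least_edges R setT = R.
Proof.
move=> tR iR; have [cR _] := andP tR.
apply: connected_sub_tree => //; last first.
  exact: (connected_least_edges hr cR (@meets_setT _ _ R)).
apply/subsetP => e /least_edges_setT[p [v [ch j]]].
by have [e' e'R j'] := child_edge tR iR ch; rewrite (joins_inj j j').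
Qed.

Lemma adj_child R x y : tree R -> increasing r R -> adj R x y ->
  child R x y || child R y x.
Proof.
move=> tR iR /adjP[e]; rewrite -{1}(elimination_tree_increasing tR iR).
case/least_edges_setT=> p [v [ch j]].
have := child_lt ch => pv; move: j; rewrite joins_lt // => /eqP eE.
by rewrite /joins eE => /orP[]/eqP[<- <-]; rewrite ch ?orbT.
Qed.

Lemma dist_le1 E x y : x != y -> (dist E x y <= 1)%N = adj E x y.
Proof.
move=> xy; have V1 : (1 < #|V|)%N.
  by apply/card_gt1P; exists x, y; split; rewrite ?inE.
rewrite /dist; set a := (fun n => _).
have a1 : a 1 = adj E x y.
  apply/existsP/idP.
    case=> -[[|z [|? ?]] //= sz] /andP[]; rewrite andbT => xz /eqP <- //.
  by move=> axy; exists [tuple y]; rewrite /= axy eqxx.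
have a0 : a 0 = false.
  apply/existsP => -[[[|? ?] //= sz]] xy'; by rewrite (negPf xy) in xy'.
case: #|V| V1 => [|[|n]] // _.
by rewrite /= a0 a1; case: (adj E x y).
Qed.

(** [p] is not a descendant of [v] and is at distance 1; any other neighbour of
    [v] is one of its children, hence a descendant. *)
Lemma parent_child R p v : tree R -> increasing r R -> child R p v ->
  parent r R v = p.
Proof.
move=> tR iR ch; have [cR _] := andP tR.
have pv := child_lt ch; have rv : r < v := le_lt_trans (hr p) pv.
have nd u : u < v -> u \notin des r R v.
  move=> uv; rewrite des_desc //; apply: contraL uv => /desc_le.
  by rewrite leNgt.
rewrite /parent; case: arg_minnP => [|u uv m]; first exact: nd.
have vu : v != u by apply: contraNneq uv => <-; rewrite des_desc // desc_refl.
have av : adj R v p.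
  by have [e eR j] := child_edge tR iR ch; rewrite adjC; apply/adjP; exists e.
have : (dist R v u <= 1)%N.
  by apply: leq_trans (m p (nd p pv)) _; rewrite dist_le1 ?gt_eqF.
rewrite dist_le1 // => /(adj_child tR iR)/orP[vuc|uvc]; last first.
  exact: child_unique uvc ch.
by case/negP: uv; rewrite des_desc // child_desc.
Qed.

Lemma J_star R p v : tree R -> increasing r R -> child R p v ->
  J r R v = star p (desc R v).
Proof.
move=> tR iR ch; apply/setP => e; rewrite !inE (parent_child tR iR ch).
by rewrite des_desc //; case/andP: tR.
Qed.

Lemma ex_parent_root Q v : connected Q -> v != r -> exists p, child Q p v.
Proof.
move=> cQ vr; apply: (@ex_parent _ _ Q r); first by rewrite desc_root // inE.
by rewrite lt_neqAle eq_sym vr hr.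
Qed.

Lemma child_neq_root Q p v : child Q p v -> v != r.
Proof. by move/child_lt => pv; rewrite gt_eqF // (le_lt_trans (hr p)). Qed.

Lemma f_least_edges G R : tree R -> increasing r R -> f G r R = least_edges R G.
Proof.
move=> tR iR; have [cR _] := andP tR.
apply/setP => e; rewrite [RHS]inE; apply/bigcupP/existsP.
  move=> [v vr em]; have [p ch] := ex_parent_root cR vr.
  by exists p; apply/existsP; exists v; rewrite ch -(J_star tR iR ch).
move=> [p /existsP[v /andP[ch em]]]; exists v; first exact: child_neq_root ch.
by rewrite (J_star tR iR ch).
Qed.

Lemma Gconnected_meets G R : tree R -> increasing r R ->
  reflect (meets R G) (Gconnected G r R).
Proof.
move=> tR iR; have [cR _] := andP tR; apply: (iffP forallP) => h.
  move=> p v ch; have := h v; rewrite (child_neq_root ch) /=.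
  by rewrite (J_star tR iR ch).
move=> v; apply/implyP => vr; have [p ch] := ex_parent_root cR vr.
by rewrite (J_star tR iR ch); apply: h.
Qed.

Lemma elimination_tree Q : connected Q -> tree (least_edges Q setT).
Proof.
by move=> cQ; case/andP: (least_edges_subtree hr cQ (@meets_setT _ _ Q)).
Qed.

(** After a step up to [y], a step down would lead to the only parent of [y],
    that is back to [x]. So a simple path that starts upwards is increasing. *)
Lemma up_path Q x y (q : seq V) : x < y -> adj (least_edges Q setT) x y ->
  path (adj (least_edges Q setT)) y q -> uniq (x :: y :: q) -> path <%O y q.
Proof.
elim: q x y => //= z q IH x y xy axy /andP[ayz pq] u.
have yz : y < z.
  have := adj_neq ayz; rewrite neq_lt => /orP[//|zy]; exfalso.
  have up a b : a < b -> adj (least_edges Q setT) a b -> child Q a b.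
    move=> ab /adjP[e /least_edges_setT[p [v [ch j]]]].
    have pv := child_lt ch; move: j; rewrite !joins_lt // => /eqP->.
    by move=> /eqP[<- <-].
  have xz : x = z.
    by apply: child_unique (up x y xy axy) (up z y zy _); rewrite adjC.
  by move: u; rewrite xz !inE eqxx orbT.
by rewrite yz (IH y) //; case/andP: u.
Qed.

Lemma elimination_increasing Q :
  connected Q -> increasing r (least_edges Q setT).
Proof.
move=> cQ; apply/forallP => v; apply/forall_inP => w /desP[q [pq uq <- vq]].
have : path <%O r q.
  case: q pq uq {vq} => //= y q /andP[ry pq] uq.
  have ry' : r < y by rewrite lt_neqAle (adj_neq ry) hr.
  by rewrite ry' (up_path ry' ry pq uq).
case/splitPl: vq {pq uq} => q1 q2 <-; rewrite cat_path last_cat => /andP[_].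
move/(order_path_min lt_trans)/allP => above.
by have := mem_last (last r q1) q2; rewrite inE => /predU1P[->|/above/ltW].
Qed.

End Rooted.

End IncreasingTrees.

(** * The recursive construction *)

Section Recursion.
Context {d : Order.disp_t} {V : finOrderType d}.
Implicit Types (e : edge V) (E G H R T Q C : graph V) (S B : {set V}).
Implicit Types (x y v w r p s : V).

Lemma desc_gt Q s x : (s < x) && (x \in desc Q s) = (x \in desc Q s :\ s).
Proof.
rewrite in_setD1; have [xs|] := boolP (x \in desc Q s); last by rewrite !andbF.
by rewrite !andbT lt_neqAle (desc_le xs) andbT eq_sym.
Qed.

(** By [child_same], a path in [desc Q s] that avoids [s] stays in the subtree
    of a child of [s]; this subtree is connected inside itself
    ([desc_restrict]). *)
Lemma block_desc Q s v x : child Q s v -> x \in desc Q v ->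
  let Qs := restrict (restrict Q (desc Q s)) (desc Q s :\ s) in
  [set y in desc Q s :\ s | connect (adj Qs) x y] = desc Q v.
Proof.
move=> ch xv Qs; have sub : {subset desc Q v <= desc Q s :\ s}.
  by move=> y yv; rewrite -desc_gt (child_le ch yv) (child_sub ch yv).
apply/setP => y; rewrite in_set; apply/andP/idP => [[_ xy]|yv].
  apply: (child_same ch xv); apply: connect_sub_rel xy => a b.
  rewrite adj_restrict_set !adj_restrict -!desc_gt.
  by move=> /and3P[/and3P[-> _ _] /andP[-> _] /andP[-> _]].
have dv u : u \in desc Q v -> connect (adj Qs) v u.
  move/desc_restrict; apply: connect_sub_rel => a b.
  rewrite !adj_restrict => /and3P[-> /sub aD /sub bD]; rewrite aD bD.
  by move: aD bD; rewrite -!desc_gt => /andP[_ ->] /andP[_ ->].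
split; first exact: sub.
by apply: connect_trans (dv _ yv); rewrite adj_csym dv.
Qed.

Lemma depth_first_partitionP Q s (B : {set V}) :
  reflect (exists2 v, child Q s v & B = desc Q v)
    (B \in depth_first_partition Q (desc Q s) s).
Proof.
apply: (iffP imsetP) => [[x]|[v ch ->]].
  rewrite -desc_gt => /andP[sx xs] ->; have [v ch xv] := ex_child xs sx.
  by exists v => //; apply: block_desc.
exists v; first by rewrite -desc_gt child_desc // (child_lt ch).
by rewrite (block_desc ch) ?desc_refl.
Qed.

Lemma minima_desc Q s x : (x \in minima (desc Q s)) = (x == s).
Proof.
have ms : s \in minima (desc Q s).
  by apply/minimaP; split; [apply: desc_refl | move=> y /desc_le].
by apply/idP/eqP => [mx|->//]; apply: minima_unique ms.
Qed.

(** The condition is on the parent [p] and not on [v], since the edge [pv] is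
    added when the recursion has reached the block [desc Q p]; this is the
    block at hand if [p = s], and otherwise it lies in the block of a child of
    [s]. *)
Lemma k_recP n Q s e : (#|desc Q s| <= n)%N ->
  reflect (exists p v, [/\ child Q p v, p \in desc Q s & joins e p v])
    (e \in k_rec n Q (desc Q s)).
Proof.
elim: n s => [|n IH] s sn.
  move: sn; rewrite leqn0 cards_eq0 => /eqP s0.
  by have := desc_refl Q s; rewrite s0 inE.
have card v : child Q s v -> (#|desc Q v| <= n)%N.
  move=> ch; rewrite -ltnS; apply: leq_trans sn; apply: proper_card.
  rewrite properE desc_sub ?(child_desc ch) //; apply/subsetPn; exists s.
    exact: desc_refl.
  by apply: contraL (child_lt ch) => /desc_le; rewrite leNgt.
apply: (iffP bigcupP) => [[s']|[p [v [ch ps j]]]].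
  rewrite minima_desc => /eqP-> {s'}; rewrite in_setU => /orP[].
    rewrite inE => /exists_inP[B /depth_first_partitionP[v ch ->]].
    move=> /exists_inP[x]; rewrite minima_desc => /eqP-> j.
    by exists s, v; rewrite desc_refl.
  case/bigcupP=> B /andP[/depth_first_partitionP[v ch ->] _].
  case/(IH _ (card v ch)) => p [w [chw pv j]].
  by exists p, w; split=> //; apply: child_sub ch pv.
exists s; rewrite ?minima_desc // in_setU; apply/orP.
have := desc_le ps; rewrite le_eqVlt => /orP[/eqP sp|sp].
  subst p; left; rewrite inE; apply/exists_inP; exists (desc Q v).
    by apply/depth_first_partitionP; exists v.
  by apply/exists_inP; exists v; rewrite ?minima_desc.
have [c chc pc] := ex_child ps sp; right; apply/bigcupP; exists (desc Q c).
  apply/andP; split; first by apply/depth_first_partitionP; exists c.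
  apply/card_gt1P; exists p, v; split=> //.
    exact: desc_trans pc (child_desc ch).
  by rewrite lt_eqF ?(child_lt ch).
by apply/(IH _ (card c chc)); exists p, v.
Qed.

Lemma k_least_edges r Q :
  (forall v, r <= v) -> connected Q -> k Q = least_edges Q setT.
Proof.
move=> hr cQ; have D := desc_root hr cQ; apply/setP => e.
rewrite /k -D; apply/k_recP/least_edges_setT; first by rewrite max_card.
  by case=> p [v [ch _ j]]; exists p, v.
by case=> p [v [ch j]]; exists p, v; rewrite D inE.
Qed.

End Recursion.

(** * The bijection *)

Theorem corollary2 (d : Order.disp_t) (V : finOrderType d) (r : V)
    (hr : forall v : V, (r <= v)%O) (G : {set edge V}) (hG : connected G) :
  [/\ {in increasing_trees G r &, injective (f G r)},
      [set f G r R | R in increasing_trees G r] = bcf_subtrees G,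
      {in increasing_trees G r, cancel (f G r) k} &
      {in bcf_subtrees G, cancel k (f G r)}].
Proof.
have fwd R : R \in increasing_trees G r ->
    (f G r R \in bcf_subtrees G) /\ k (f G r R) = R.
  rewrite inE => /and3P[tR iR /(Gconnected_meets hr G tR iR) mR].
  have [cR _] := andP tR; rewrite (f_least_edges hr) // inE.
  have sF := least_edges_subtree hr cR mR.
  have cF := connected_least_edges hr cR mR.
  rewrite sF least_edges_bcf // (k_least_edges hr cF); split=> //.
  rewrite -[RHS](elimination_tree_increasing hr tR iR).
  apply: eq_least_edges => v.
  exact: desc_least_edges.
have bwd T : T \in bcf_subtrees G ->
    (k T \in increasing_trees G r) /\ f G r (k T) = T.
  rewrite inE => /andP[/andP[TG tT] bcfT]; have [cT _] := andP tT.
  have tk := elimination_tree hr cT; have ik := elimination_increasing hr cT.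
  have mT := meets_sub TG.
  have dk := fun v => desc_least_edges v (@meets_setT _ _ T).
  rewrite (k_least_edges hr cT) inE tk ik (f_least_edges hr) //; split.
    apply/(Gconnected_meets hr G tk ik) => p v.
    by rewrite (eq_child dk) dk; apply: mT.
  rewrite (eq_least_edges _ dk); apply: connected_sub_tree => //.
    exact: bcf_least_edges.
  exact: connected_least_edges hr cT mT.
have fK : {in increasing_trees G r, cancel (f G r) k} by move=> R /fwd[].
split; [exact: can_in_inj fK | | exact: fK | by move=> T /bwd[]].
apply/setP => T; apply/imsetP/idP => [[R /fwd[? _] -> //]|/bwd[kT fT]].
by exists (k T).
Qed.
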